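(* Let $A,P\in\mathbb{R}^{n\times n}$ be invertible and $b\in\mathbb{R}^n$, and consider solving $g(x)=Ax-b=0$. Consider full NGMRESr applied to the preconditioned Richardson iteration $q(x)=x+P(b-Ax)$, and left-preconditioned GMRES with left preconditioner $P$ applied to $Ax=b$, both with the same initial guess $x_0$. Let $\{x_i\}$ and $\{x_i^{Gl}\}$ be the sequences generated by full NGMRESr and left-preconditioned GMRES, respectively, and let $r_i^{Gl}=P(Ax_i^{Gl}-b)$. Assume that for some $k^*\in\mathbb{Z}^+$, $r^{Gl}_{k^*-1}\neq0$ and $\|r^{Gl}_k\|<\|r^{Gl}_{k-1}\|$ for all $k$ with $0<k<k^*$. Then $x_k=x_k^{Gl}$ for all $0\le k\le k^*$.
   Context: $\|\cdot\|$ is the Euclidean 2-norm, and $r(x)=x-q(x)=P(Ax-b)$. Full NGMRESr: given $x_0\in\mathbb{R}^n$, for $k=0,1,2,\dots$ set $$x_{k+1}=q(x_k)+\sum_{i=0}^{k}\beta_i^{(k)}\big(q(x_k)-x_{k-i}\big),$$ where $\boldsymbol{\beta}^{(k)}=(\beta_0^{(k)},\dots,\beta_k^{(k)})\in\mathbb{R}^{k+1}$ is a minimizer of $$\Big\|r(q(x_k))+\sum_{i=0}^{k}\beta_i^{(k)}\big(r(q(x_k))-r(x_{k-i})\big)\Big\|^2 .$$ Left-preconditioned GMRES with preconditioner $P$ and initial guess $x_0$: let $r_0=P(Ax_0-b)$ and $\mathcal{K}_k(PA,r_0)=\mathrm{span}\{r_0,PAr_0,\dots,(PA)^{k-1}r_0\}$.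 Then $x_0^{Gl}=x_0$ and, for $k\ge1$, $x_k^{Gl}=x_0+z_k$, where $z_k\in\mathcal{K}_k(PA,r_0)$ minimizes $\|r_0+PAz\|$ over $z\in\mathcal{K}_k(PA,r_0)$. *)

(* Defs.v *)
From mathcomp Require Import all_boot all_order all_algebra.
From mathcomp Require Import reals.

Set Implicit Arguments.
Unset Strict Implicit.
Unset Printing Implicit Defensive.

Import Order.TTheory GRing.Theory Num.Theory.
Local Open Scope ring_scope.

(* R^n is 'cV[R]_n. The norm that MathComp-Analysis puts on matrices is the
   sup norm, hence the explicit Euclidean norm here. *)
Definition enorm (R : realType) (n : nat) (v : 'cV[R]_n) : R :=
  Num.sqrt (\sum_(i < n) v i 0 ^+ 2).

Definition richardson (R : realType) (n : nat) (A P : 'M[R]_n) (b : 'cV[R]_n)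
    (x : 'cV[R]_n) : 'cV[R]_n :=
  x + P *m (b - A *m x).

Definition fp_residual (R : realType) (n : nat) (q : 'cV[R]_n -> 'cV[R]_n)
    (x : 'cV[R]_n) : 'cV[R]_n :=
  x - q x.

Definition prec_residual (R : realType) (n : nat) (A P : 'M[R]_n)
    (b x : 'cV[R]_n) : 'cV[R]_n :=
  P *m (A *m x - b).

Lemma fp_residual_richardson (R : realType) (n : nat) (A P : 'M[R]_n)
    (b x : 'cV[R]_n) :
  fp_residual (richardson A P b) x = prec_residual A P b x.
Proof.
by rewrite /fp_residual /richardson /prec_residual opprD addrA subrr add0r
  -mulmxN opprB.
Qed.

Definition ngmresr_next (R : realType) (n : nat) (q : 'cV[R]_n -> 'cV[R]_n)
    (x : nat -> 'cV[R]_n) (k : nat) (beta : 'cV[R]_k.+1) : 'cV[R]_n :=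
  q (x k) + \sum_(i < k.+1) beta i 0 *: (q (x k) - x (k - i)%N).

Definition ngmresr_objective (R : realType) (n : nat)
    (q : 'cV[R]_n -> 'cV[R]_n) (x : nat -> 'cV[R]_n) (k : nat)
    (beta : 'cV[R]_k.+1) : R :=
  let r := fp_residual q in
  enorm (r (q (x k)) +
         \sum_(i < k.+1) beta i 0 *: (r (q (x k)) - r (x (k - i)%N))) ^+ 2.

(* The least-squares minimizer need not be unique, so an NGMRESr run is a
   relation: any minimizer may be chosen at each step. *)
Definition full_ngmresr (R : realType) (n : nat) (q : 'cV[R]_n -> 'cV[R]_n)
    (x0 : 'cV[R]_n) (x : nat -> 'cV[R]_n) : Prop :=
  x 0%N = x0 /\
  forall k : nat, exists beta : 'cV[R]_k.+1,
    (forall gamma : 'cV[R]_k.+1,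
       ngmresr_objective q x beta <= ngmresr_objective q x gamma) /\
    x k.+1 = ngmresr_next q x beta.

Definition krylov (R : realType) (n : nat) (M : 'M[R]_n) (v : 'cV[R]_n)
    (k : nat) : {vspace 'cV[R]_n} :=
  <<[seq M ^+ j *m v | j <- iota 0 k]>>%VS.

Definition left_gmres (R : realType) (n : nat) (A P : 'M[R]_n)
    (b x0 : 'cV[R]_n) (x : nat -> 'cV[R]_n) : Prop :=
  let r0 := prec_residual A P b x0 in
  let M := P *m A in
  x 0%N = x0 /\
  forall k : nat, (0 < k)%N -> exists z : 'cV[R]_n,
    [/\ z \in krylov M r0 k,
        forall w : 'cV[R]_n, w \in krylov M r0 k ->
          enorm (r0 + M *m z) <= enorm (r0 + M *m w)
      & x k = x0 + z].

(* Main.v *)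
Require Import Defs.
From mathcomp Require Import all_boot all_order all_algebra.
From mathcomp Require Import reals ring lra.

Import Order.TTheory GRing.Theory Num.Theory.
Local Open Scope ring_scope.

(** Write [M = P A], [r0 = P (A x0 - b)] and [K_k] for the Krylov spaces of [M]
    and [r0].  Both methods choose [x_{k+1} = x0 + z] with [z] minimizing
    [|r0 + M z|] over a linear space: [K_{k+1}] for GMRES, and for NGMRESr the
    span of the vectors [q(x_k) - x_j], [j <= k].  The latter holds because the
    new iterate is an arbitrary affine combination of [q(x_k), x_0, ..., x_k]
    and because the residual is an affine function of the iterate
    ([ngmresr_min_residual]).  A minimizer over a fixed space is unique, since
    the Euclidean norm is strictly convex and [M] is injective
    ([min_residual_unique]).  Hence it suffices that the two search spaces
    coincide as long as the iterates have coincided so far ([ngmresr_dirsE]).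

    That the NGMRESr directions lie in [K_{k+1}] is immediate.  Conversely, a
    strict decrease of the residual at step [j] means that [z_j = x_j - x0]
    lies in [K_j] but not in [K_{j-1}], so that [z_j] has a nonzero component
    along [M^(j-1) r0].  Moreover [q(x_k) - x0 = z_k - r0 - M z_k] then has
    a nonzero component along [M^k r0].  So the directions contain one vector
    of each exact Krylov degree [0, ..., k], and a triangular elimination
    recovers all of [K_{k+1}] ([krylov_subv]). *)

(** * Strict convexity and unique minimizers *)

Section EuclideanNorm.
Variables (R : realType) (n : nat).
Implicit Types u v : 'cV[R]_n.

Lemma enorm_ge0 v : 0 <= enorm v.
Proof. exact: sqrtr_ge0. Qed.

Lemma enorm_sqr v : enorm v ^+ 2 = \sum_(i < n) v i 0 ^+ 2.
Proof. by rewrite sqr_sqrtr // sumr_ge0 // => i _; rewrite sqr_ge0. Qed.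

Lemma enorm_sqr_eq0 v : enorm v ^+ 2 <= 0 -> v = 0.
Proof.
rewrite enorm_sqr => le0.
have /eqP : \sum_(i < n) v i 0 ^+ 2 = 0.
  by apply/eqP; rewrite eq_le le0 sumr_ge0 // => i _; rewrite sqr_ge0.
rewrite psumr_eq0 => [/allP all0|i _]; last exact: sqr_ge0.
apply/matrixP => i j; rewrite ord1 mxE.
by have := all0 i (mem_index_enum i); rewrite /= sqrf_eq0 => /eqP.
Qed.

Lemma enorm_parallelogram u v :
  enorm (u - v) ^+ 2 + enorm (u + v) ^+ 2
    = (enorm u ^+ 2 + enorm v ^+ 2) *+ 2.
Proof.
rewrite !enorm_sqr -!big_split -sumrMnl; apply: eq_bigr => i _.
by rewrite /= !mxE; ring.
Qed.

Lemma enormZ (a : R) v : enorm (a *: v) ^+ 2 = a ^+ 2 * enorm v ^+ 2.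
Proof.
by rewrite !enorm_sqr mulr_sumr; apply: eq_bigr => i _; rewrite mxE exprMn.
Qed.

(** Strict convexity of the norm: the midpoint of two distinct vectors of
    equal length is strictly shorter than they are. *)
Lemma enorm_midpoint_eq u v :
  enorm u <= enorm (2^-1 *: (u + v)) -> enorm v <= enorm (2^-1 *: (u + v)) ->
  u = v.
Proof.
rewrite -ler_sqr ?nnegrE ?enorm_ge0 // enormZ => hu.
rewrite -ler_sqr ?nnegrE ?enorm_ge0 // enormZ => hv.
apply/eqP; rewrite -subr_eq0; apply/eqP/enorm_sqr_eq0.
have := enorm_parallelogram u v; lra.
Qed.

End EuclideanNorm.

(** The common variational description of both methods: [z] is the correction
    of minimal residual in the search space [V]. *)
Definition min_residual {R : realType} {n : nat} (M : 'M[R]_n) (r0 : 'cV[R]_n)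
    (V : {vspace 'cV[R]_n}) (z : 'cV[R]_n) : Prop :=
  z \in V /\ forall w, w \in V -> enorm (r0 + M *m z) <= enorm (r0 + M *m w).

Lemma min_residual_unique {R : realType} {n : nat} (M : 'M[R]_n)
    (r0 : 'cV[R]_n) (V : {vspace 'cV[R]_n}) (y z : 'cV[R]_n) :
  M \in unitmx -> min_residual M r0 V y -> min_residual M r0 V z -> y = z.
Proof.
move=> Mu [yV ymin] [zV zmin].
have midV : 2^-1 *: (y + z) \in V by rewrite memvZ // memvD.
have mid : r0 + M *m (2^-1 *: (y + z))
           = 2^-1 *: ((r0 + M *m y) + (r0 + M *m z)).
  rewrite addrACA -mulmxDr [RHS]scalerDr -scalemxAr -mulr2n -[r0 *+ 2]scaler_nat.
  by rewrite scalerA mulVf ?scale1r // pnatr_eq0.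
have := ymin _ midV; have := zmin _ midV; rewrite mid => hz hy.
have /addrI Myz := enorm_midpoint_eq _ _ _ _ hy hz.
by rewrite -(mulKmx Mu y) Myz mulKmx.
Qed.

(** * Krylov spaces *)

Section Krylov.
Context {R : realType} {n : nat}.
Implicit Types (M : 'M[R]_n) (v w : 'cV[R]_n).

Lemma krylovS M v k :
  krylov M v k.+1 = (krylov M v k + <[M ^+ k *m v]>)%VS.
Proof. by rewrite /krylov -[in LHS](addn1 k) iotaD map_cat span_cat /= span_seq1. Qed.

Lemma krylov0 M v : krylov M v 0 = 0%VS.
Proof. exact: span_nil. Qed.

Lemma krylovSP M v k w :
  reflect (exists2 u, u \in krylov M v k & exists c, w = u + c *: (M ^+ k *m v))
          (w \in krylov M v k.+1).
Proof.
rewrite krylovS; apply: (iffP memv_addP).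
  by case=> u uK [_ /vlineP[c ->] ->]; exists u => //; exists c.
case=> u uK [c ->]; exists u => //.
by exists (c *: (M ^+ k *m v)) => //; rewrite memvZ ?memv_line.
Qed.

Lemma krylov_leq M v i j : (i <= j)%N -> (krylov M v i <= krylov M v j)%VS.
Proof.
move=> /subnK <-; elim: (j - i)%N => [|d IHd]; first exact: subvv.
by rewrite addSn krylovS; apply: subv_trans IHd (addvSl _ _).
Qed.

Lemma krylov_power M v k : M ^+ k *m v \in krylov M v k.+1.
Proof. by rewrite krylovS; apply: (subvP (addvSr _ _)); apply: memv_line. Qed.

Lemma mulmx_power M v k : M *m (M ^+ k *m v) = M ^+ k.+1 *m v.
Proof. by rewrite exprS mulmxA. Qed.

Lemma krylov_mul M v k w :
  w \in krylov M v k -> M *m w \in krylov M v k.+1.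
Proof.
elim: k w => [|k IHk] w.
  by rewrite krylov0 memv0 => /eqP->; rewrite mulmx0 mem0v.
case/krylovSP=> u uK [c ->]; rewrite mulmxDr -scalemxAr mulmx_power.
apply: memvD; last by rewrite memvZ // krylov_power.
by apply: subvP (IHk _ uK); apply: krylov_leq.
Qed.

(** Triangular elimination: a space containing, for each [j < k], a vector of
    exact Krylov degree [j] contains all of [K_k].  The leading coefficient is
    explicit because [M ^+ j *m v] may itself lie in [K_j], in which case no
    vector of degree [j] lies outside [K_j]. *)
Lemma krylov_subv M v k (W : {vspace 'cV[R]_n}) :
  (forall j, (j < k)%N ->
     exists2 c, c != 0 &
     exists2 u, u \in krylov M v j & u + c *: (M ^+ j *m v) \in W) ->
  (krylov M v k <= W)%VS.
Proof.
elim: k => [|k IHk] degW; first by rewrite krylov0 sub0v.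
have KkW : (krylov M v k <= W)%VS.
  by apply: IHk => j jk; apply: degW; apply: ltnW.
have [c c0 [u uK ucW]] := degW k (ltnSn k).
rewrite krylovS subv_add KkW -memvE /=.
have := memvB ucW (subvP KkW _ uK); rewrite addrC addKr => cW.
by rewrite -[M ^+ k *m v](scalerK c0) memvZ.
Qed.

End Krylov.

(** * Search directions of NGMRESr *)

Section Directions.
Context {R : realType} {n : nat}.

Definition ngmresr_dirs (q : 'cV[R]_n -> 'cV[R]_n) (x : nat -> 'cV[R]_n)
    (k : nat) : {vspace 'cV[R]_n} :=
  <<[tuple q (x k) - x (k - i)%N | i < k.+1]>>%VS.

Variables (q : 'cV[R]_n -> 'cV[R]_n) (x : nat -> 'cV[R]_n) (k : nat).

Lemma mem_ngmresr_dirs j :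
  (j <= k)%N -> q (x k) - x j \in ngmresr_dirs q x k.
Proof.
move=> jk; apply: memv_span.
apply/tnthP; exists (inord (k - j)).
by rewrite tnth_mktuple inordK ?ltnS ?leq_subr // subKn.
Qed.

(** Taking all coefficients [0] except [-1] on [x 0] reproduces [x 0]; shifting
    the coefficients by this choice turns the affine parametrization of the new
    iterate into a linear one. *)
Lemma ngmresr_nextE (beta : 'cV[R]_k.+1) :
  ngmresr_next q x beta
    = x 0 + \sum_(i < k.+1)
              (beta + delta_mx ord_max 0) i 0 *: (q (x k) - x (k - i)%N).
Proof.
rewrite /ngmresr_next.
under [in RHS]eq_bigr => i _ do rewrite mxE scalerDl.
rewrite big_split /= addrCA [RHS]addrC; congr (_ + _).
rewrite (bigD1 ord_max) //= big1 => [|i /negPf iM].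
  by rewrite mxE !eqxx scale1r subnn addr0 addrC subrK.
by rewrite mxE iM scale0r.
Qed.

Lemma ngmresr_nextP (y : 'cV[R]_n) :
  (exists beta : 'cV[R]_k.+1, y = ngmresr_next q x beta)
    <-> y - x 0 \in ngmresr_dirs q x k.
Proof.
split=> [[beta ->]|/coord_span yE].
  rewrite ngmresr_nextE addrC addKr memv_suml // => i _.
  by rewrite memvZ // mem_ngmresr_dirs // leq_subr.
exists ((\col_i coord [tuple q (x k) - x (k - i)%N | i < k.+1] i (y - x 0))
        - delta_mx ord_max 0).
rewrite ngmresr_nextE subrK -[LHS](subrK (x 0)) addrC; congr (_ + _).
rewrite [LHS]yE; apply: eq_bigr => i _.
by rewrite mxE -tnth_nth tnth_mktuple.
Qed.

End Directions.

(** * Comparison with GMRES *)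

Section Comparison.
Context {R : realType} {n : nat} (A P : 'M[R]_n) (b : 'cV[R]_n).
Let M := P *m A.
Let q := richardson A P b.
Let r := prec_residual A P b.

Lemma prec_residualD (y z : 'cV[R]_n) : r (y + z) = r y + M *m z.
Proof. by rewrite /r /prec_residual [A *m (y + z)]mulmxDr addrAC [LHS]mulmxDr /M -mulmxA. Qed.

Lemma ngmresr_objectiveE (x : nat -> 'cV[R]_n) k (beta : 'cV[R]_k.+1) :
  ngmresr_objective q x beta = enorm (r (ngmresr_next q x beta)) ^+ 2.
Proof.
rewrite /ngmresr_objective /ngmresr_next prec_residualD mulmx_sumr.
rewrite fp_residual_richardson; congr (enorm (_ + _) ^+ 2).
apply: eq_bigr => i _; rewrite !fp_residual_richardson -scalemxAr -/r.
rewrite -[X in r X](subrK (x (k - i)%N)) [X in r X]addrC.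
by rewrite prec_residualD addrC addKr.
Qed.

Lemma ngmresr_min_residual (x : nat -> 'cV[R]_n) (x0 : 'cV[R]_n) k :
  full_ngmresr q x0 x ->
  min_residual M (r x0) (ngmresr_dirs q x k) (x k.+1 - x0).
Proof.
case=> x00 /(_ k)[beta [betamin xk]].
have nextP := ngmresr_nextP q x k; rewrite x00 in nextP.
split=> [|w wW]; first by apply/nextP; exists beta.
have /nextP[gamma wE] : (x0 + w) - x0 \in ngmresr_dirs q x k.
  by rewrite addrC addKr.
rewrite -!prec_residualD addrC subrK wE xk.
by rewrite -ler_sqr ?nnegrE ?enorm_ge0 // -!ngmresr_objectiveE.
Qed.

Lemma left_gmres_min_residual (x : nat -> 'cV[R]_n) (x0 : 'cV[R]_n) k :
  left_gmres A P b x0 x ->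
  min_residual M (r x0) (krylov M (r x0) k) (x k - x0).
Proof.
case=> x00; case: k => [|k] gm.
  rewrite x00 subrr krylov0; split=> [|w]; first exact: mem0v.
  by rewrite memv0 => /eqP->.
by have [z [zK zmin ->]] := gm k.+1 isT; rewrite addrC addKr.
Qed.

(** A strictly smaller residual cannot be reached inside the previous Krylov
    space, so the correction involves the newest Krylov vector. *)
Lemma gmres_degree (x : nat -> 'cV[R]_n) (x0 : 'cV[R]_n) k :
  left_gmres A P b x0 x -> enorm (r (x k.+1)) < enorm (r (x k)) ->
  exists2 c, c != 0 &
  exists2 u, u \in krylov M (r x0) k &
    x k.+1 - x0 = u + c *: (M ^+ k *m r x0).
Proof.
move=> gm dec.
have [/krylovSP[u uK [c zE]] _] := left_gmres_min_residual x x0 k.+1 gm.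
exists c; last by exists u.
apply/eqP => c0; move: dec; rewrite ltNge => /negP; apply.
have [_ /(_ u uK)] := left_gmres_min_residual x x0 k gm.
rewrite c0 scale0r addr0 in zE.
by rewrite -zE -!prec_residualD ![x0 + _]addrC !subrK.
Qed.

(** Since [q (x k) - x0 = (x k - x0) - r x0 - M (x k - x0)] and multiplication
    by [M] raises Krylov degrees by one, the degree [k - 1] of [x k - x0] turns
    into [k]; for [k = 0] only [- r x0] remains. *)
Lemma richardson_degree (x : nat -> 'cV[R]_n) (x0 : 'cV[R]_n) k :
  left_gmres A P b x0 x ->
  ((0 < k)%N -> enorm (r (x k)) < enorm (r (x k.-1))) ->
  exists2 c, c != 0 &
  exists2 u, u \in krylov M (r x0) k &
    q (x k) - x0 = u + c *: (M ^+ k *m r x0).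
Proof.
move=> gm dec.
have qE : q (x k) - x0 = (x k - x0) - r x0 - M *m (x k - x0).
  rewrite -[RHS]addrA -opprD -prec_residualD [x0 + _]addrC subrK.
  rewrite [RHS]addrAC; congr (_ - _); rewrite /r -fp_residual_richardson.
  by rewrite /fp_residual opprB addrC subrK.
case: k => [|k] in dec qE *.
  have [x00 _] := gm; exists (-1); first by rewrite oppr_eq0 oner_eq0.
  exists 0; first exact: mem0v.
  by rewrite qE x00 subrr mulmx0 subr0 !add0r expr0 mul1mx scaleN1r.
have [c c0 [u uK zE]] := gmres_degree x x0 k gm (dec isT).
have [zK _] := left_gmres_min_residual x x0 k.+1 gm.
exists (- c); first by rewrite oppr_eq0.
exists ((x k.+1 - x0) - r x0 - M *m u).
  have /(subvP (krylov_leq _ _ _ _ (ltn0Sn k))) := krylov_power M (r x0) 0.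
  by rewrite expr0 mul1mx => r0K; rewrite (memvB (memvB zK r0K)) ?krylov_mul.
rewrite qE [in M *m (_ - _)]zE mulmxDr -scalemxAr mulmx_power.
by rewrite opprD addrA scaleNr.
Qed.

Lemma ngmresr_dirsE (x xGl : nat -> 'cV[R]_n) (x0 : 'cV[R]_n) k :
  left_gmres A P b x0 xGl ->
  (forall j, (0 < j <= k)%N -> enorm (r (xGl j)) < enorm (r (xGl j.-1))) ->
  (forall j, (j <= k)%N -> x j = xGl j) ->
  ngmresr_dirs q x k = krylov M (r x0) k.+1.
Proof.
move=> gm dec xE; have [x00 _] := gm.
have [c c0 [u uK qE]] : exists2 c, c != 0 &
    exists2 u, u \in krylov M (r x0) k &
      q (xGl k) - x0 = u + c *: (M ^+ k *m r x0).
  by apply: richardson_degree => // k0; apply: dec; rewrite k0 leqnn.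
have q0W : q (xGl k) - x0 \in ngmresr_dirs q x k.
  by rewrite -(xE k) // -x00 -(xE 0%N) // mem_ngmresr_dirs.
apply/eqP; rewrite eqEsubv; apply/andP; split.
  apply/span_subvP => _ /tnthP[i ->]; rewrite tnth_mktuple !xE ?leq_subr //.
  rewrite -[q _](subrK x0) -addrA -[x0 - _]opprB memvB //.
    by apply/krylovSP; exists u => //; exists c.
  have [zK _] := left_gmres_min_residual xGl x0 (k - i) gm.
  by apply: subvP zK; apply: krylov_leq; rewrite leqW ?leq_subr.
apply: krylov_subv => j; rewrite ltnS leq_eqVlt => /predU1P[->|jk].
  by exists c => //; exists u => //; rewrite -qE.
have [d d0 [w wK zE]] := gmres_degree xGl x0 j gm (dec j.+1 jk).
exists d => //; exists w => //; rewrite -zE -(xE j.+1) //.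
have := memvB q0W (mem_ngmresr_dirs q x k j.+1 jk).
by rewrite (xE k) // opprB addrC addrA subrK.
Qed.

End Comparison.

Theorem theorem3p4 (R : realType) (n : nat) (A P : 'M[R]_n) (b x0 : 'cV[R]_n)
    (x xGl : nat -> 'cV[R]_n) (kstar : nat)
    (hA : A \in unitmx) (hP : P \in unitmx)
    (hx : full_ngmresr (richardson A P b) x0 x)
    (hxGl : left_gmres A P b x0 xGl)
    (hkstar : (0 < kstar)%N)
    (hnz : prec_residual A P b (xGl kstar.-1) != 0)
    (hdec : forall k : nat, (0 < k)%N -> (k < kstar)%N ->
       enorm (prec_residual A P b (xGl k))
         < enorm (prec_residual A P b (xGl k.-1))) :
  forall k : nat, (k <= kstar)%N -> x k = xGl k.
Proof.
elim/ltn_ind=> -[|k] IHk kk; first by rewrite hx.1 hxGl.1.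
have Mu : P *m A \in unitmx by rewrite unitmx_mul hP.
apply: (addIr (- x0)); apply: (min_residual_unique _ _ _ _ _ Mu).
  exact: ngmresr_min_residual hx.
rewrite (ngmresr_dirsE A P b x xGl x0) //.
- exact: left_gmres_min_residual.
- by move=> j /andP[j0 jk]; apply: hdec => //; apply: leq_ltn_trans kk.
- by move=> j jk; apply: IHk => //; apply: leq_trans jk (ltnW kk).
Qed.
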